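(* Let $G$ be a nontrivial finite CIS group. Then $G$ is abelian, and in fact $G$ is isomorphic to either the cyclic group $\mathbb{Z}_p$ or the cyclic group $\mathbb{Z}_{p^2}$ for some prime $p$, or to $\mathbb{Z}_2\times\mathbb{Z}_2$.
   Context: All groups are finite. For a group $G$ and a symmetric subset $S\subseteq G$ (i.e. $S=S^{-1}$), the Cayley graph $\mathrm{Cay}(G,S)$ has vertex set $G$, with $x,y$ adjacent iff $xy^{-1}\in S$. A graph is integral if all eigenvalues of its adjacency matrix are integers. A group $G$ is a CIS group (Cayley integral simple) if the only connected integral Cayley graphs of $G$ are complete multipartite graphs; equivalently, for every symmetric generating set $S$ of $G$ with $1\notin S$, $\mathrm{Cay}(G,S)$ is integral if and only if $G\setminus S$ is a subgroup of $G$. *)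

(* Defs.v *)
From HB Require Import structures.
From mathcomp Require Import all_boot all_order all_algebra.
From mathcomp Require Import all_fingroup all_solvable all_field.
Set Implicit Arguments.
Unset Strict Implicit.
Unset Printing Implicit Defensive.
Import Order.TTheory GRing.Theory Num.Theory.
Local Open Scope ring_scope.

Definition connected_graph (V : finType) (e : rel V) : Prop :=
  forall x y : V, connect e x y.

Definition adjacency_mx (V : finType) (e : rel V) : 'M[algC]_#|V| :=
  \matrix_(i, j) (e (enum_val i) (enum_val j))%:R.

(* The entries are 0 or 1, so all complex eigenvalues are algebraic and taking
   algC as the field of scalars misses none of them. *)
Definition integral_graph (V : finType) (e : rel V) : Prop :=
  forall a : algC, eigenvalue (adjacency_mx e) a -> a \in Num.int.

Definition complete_multipartite (V : finType) (e : rel V) : Prop :=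
  exists2 P : {set {set V}}, partition P [set: V] &
    forall x y : V, e x y = (pblock P x != pblock P y).

(* The vertex type is the subtype [subg G] of gT, so that vertices are exactly
   the elements of G. *)
Definition Cay (gT : finGroupType) (G : {group gT}) (S : {set gT}) :
    rel [subg G] :=
  fun x y => (sgval x * (sgval y)^-1)%g \in S.
Arguments Cay {gT} G S.

(* Graphs are simple, whence the condition 1 \notin S. *)
Definition CIS (gT : finGroupType) (G : {group gT}) : Prop :=
  forall S : {set gT}, S \subset G -> (S^-1 = S)%g -> 1%g \notin S ->
    connected_graph (Cay G S) -> integral_graph (Cay G S) ->
    complete_multipartite (Cay G S).

(* Main.v *)
(** For commuting matrices [A_H], each satisfying [A_H ^ 2 = #|H| A_H], every
    integer combination has integral spectrum. Applied to the adjacency matrices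
    of cosets of subgroups of G, this yields integral Cayley graphs whose
    connection set S has a complement that is rarely a subgroup. For K <= H < G,
    taking S = (G \ H) u (K \ 1) forces K = 1 or K = H, so that every proper
    subgroup of G is trivial or of prime order, and G has a normal subgroup N of
    prime order. If some Q of prime order meets N trivially, then G = NQ, and
    S = (N u Q) \ 1 forces |N| = |Q| = 2; otherwise G is cyclic of order p or
    p ^ 2. *)
Require Import Defs.
From HB Require Import structures.
From mathcomp Require Import all_boot all_order all_algebra.
From mathcomp Require Import all_fingroup all_solvable all_field.
From mathcomp Require Import vcharacter zify.
Set Implicit Arguments.
Unset Strict Implicit.
Unset Printing Implicit Defensive.
Import Order.TTheory GRing.Theory Num.Theory.
Local Open Scope group_scope.

Local Notation "A *m B" := (mulmx A B) : group_scope.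

(** * Simultaneous eigenvectors of commuting matrices *)

(** The matrices [B] are handled one at a time: either [v *m B] is zero and [v] has eigenvalue 0 for
    [B], or [v *m B] replaces [v] and has eigenvalue [m]. Commutation preserves the eigenvalues
    already obtained. *)
Lemma common_eigenvector n (Bs : seq 'M[algC]_n) (A : 'M[algC]_n) a :
    eigenvalue A a ->
    {in Bs, forall B, exists2 m, m \in Num.int & B *m B = (m *: B)%R} ->
    {in Bs, forall B, B *m A = A *m B} ->
    {in Bs &, forall B C, B *m C = C *m B} ->
  exists v : 'rV_n, [/\ v != 0%R, v *m A = (a *: v)%R
    & {in Bs, forall B, exists2 b, b \in Num.int & v *m B = (b *: v)%R}].
Proof.
move=> Aa; elim: Bs => [|B Bs IH] sqB cAB cBB.
  by have [v vA nzv] := eigenvalueP Aa; exists v.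
have sBs C : C \in Bs -> C \in B :: Bs by rewrite inE orbC => ->.
have [||| v [nzv vA vBs]] := IH.
- by move=> C /sBs; apply: sqB.
- by move=> C /sBs; apply: cAB.
- by move=> C D /sBs CB /sBs; apply: cBB.
have BB : B \in B :: Bs by rewrite mem_head.
have [vB0 | nzvB] := eqVneq (v *m B) 0%R.
  exists v; split=> // C /predU1P[-> | /vBs//].
  by exists 0%R; rewrite ?rpred0 // vB0 scale0r.
exists (v *m B); split=> //.
  by rewrite -mulmxA cAB // mulmxA vA scalemxAl.
move=> C /predU1P[-> | CBs].
  by have [m Zm sqBm] := sqB B BB; exists m; rewrite // -mulmxA sqBm scalemxAr.
have [b Zb vC] := vBs C CBs; exists b => //.
by rewrite -mulmxA (cBB B C BB (sBs C CBs)) mulmxA vC scalemxAl.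
Qed.

(** * Adjacency matrices of Cayley graphs *)

Section CayleyMatrix.

Variables (gT : finGroupType) (G : {group gT}).
Implicit Types (S : {set gT}) (H K : {group gT}).

Local Notation mxC S := (adjacency_mx (Cay G S)).
Local Notation mx1C g := (adjacency_mx (Cay G [set g])).

Lemma adjacency_Cay_sum S : (mxC S = \sum_(s in S) mx1C s)%R.
Proof.
apply/matrixP=> i j; rewrite summxE !mxE.
under eq_bigr do rewrite mxE.
rewrite /Cay; set x := (_ * _)%g.
have [xS | xS] := boolP (x \in S).
  rewrite (bigD1 x) //= set11 big1 ?addr0 // => s /andP[_ /negPf].
  by rewrite inE eq_sym => ->.
rewrite big1 // => s sS; rewrite inE; case: eqP => // xs.
by rewrite xs sS in xS.
Qed.

(** These are permutation matrices of left translations; [g \in G] keeps the intermediate vertex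
    [g^-1 * x] inside [G]. *)
Lemma adjacency_Cay1M g h : g \in G -> mx1C g *m mx1C h = mx1C (g * h).
Proof.
move=> gG; apply/matrixP=> i k; rewrite !mxE.
have memG (x : [subg G]) : sgval x \in G := subgP x.
pose x := sgval (enum_val i); pose j0 := enum_rank (subg G (g^-1 * x)).
have j0E : sgval (enum_val j0) = g^-1 * x.
  by rewrite enum_rankK subgK // groupM ?groupV ?memG.
rewrite (bigD1 j0) //= big1 => [|j nj].
  rewrite !mxE /Cay j0E -/x !inE invMg invgK mulVKg eqxx mul1r addr0.
  by rewrite -mulgA -(inj_eq (mulgI g)) mulKVg.
rewrite !mxE /Cay -/x !inE; case: eqP => [xj | _]; last by rewrite mul0r.
case/eqP: nj; apply: enum_val_inj; apply: val_inj.
by rewrite -[val _]/(sgval _) -[val _]/(sgval _) j0E -xj invMg invgK mulgKV.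
Qed.

(** Left multiplication by any [s] in [H] permutes [H], so each of the [#|H|] terms contributes a
    full copy of the matrix. *)
Lemma adjacency_Cay_sqr H : H \subset G ->
  mxC H *m mxC H = (#|H|%:R *: mxC H)%R.
Proof.
move=> sHG; rewrite {1}adjacency_Cay_sum mulmx_suml scaler_nat -sumr_const.
apply: eq_bigr => s sH; rewrite (adjacency_Cay_sum H) mulmx_sumr.
rewrite [RHS](reindex_inj (mulgI s)) /=; apply: eq_big => [h | h hH].
  by rewrite groupMl.
by rewrite adjacency_Cay1M // (subsetP sHG).
Qed.

(** Conjugation by [k] permutes [H], and [h * k = k * h ^ k]. *)
Lemma adjacency_Cay_comm H K : H \subset G -> K \subset G -> K \subset 'N(H) ->
  mxC H *m mxC K = mxC K *m mxC H.
Proof.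
move=> /subsetP sHG /subsetP sKG /subsetP nHK.
rewrite (adjacency_Cay_sum K) mulmx_sumr mulmx_suml; apply: eq_bigr => k kK.
rewrite (adjacency_Cay_sum H) mulmx_sumr mulmx_suml.
rewrite [RHS](reindex_inj (conjg_inj k)) /=.
apply: eq_big => [h|h hH]; first by rewrite memJ_norm ?nHK.
by rewrite !adjacency_Cay1M ?(sHG h hH) ?(sKG k kK) // conjgC.
Qed.

(** The normalizer condition makes the subgroup matrices commute, so some eigenvector for [a] is
    common to all of them, and [a] is an integer combination of their integer eigenvalues. *)
Lemma integral_Cay_span (r : seq (int * {group gT})) S :
    (forall p, p \in r -> p.2 \subset G) ->
    (forall p q, p \in r -> q \in r ->
      (p.2 \subset 'N(q.2)) || (q.2 \subset 'N(p.2))) ->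
    {in G, forall x, (x \in S)%:Z = \sum_(p <- r) p.1 * (x \in p.2)%:Z}%R ->
  integral_graph (Cay G S).
Proof.
move=> sG nr Sx a Aa.
have defA : (mxC S = \sum_(p <- r) p.1%:~R *: mxC p.2)%R.
  apply/matrixP=> i j; rewrite summxE !mxE /Cay; set x := (_ * _)%g.
  have xG : x \in G by rewrite groupM ?groupV ?subgP.
  rewrite -[LHS]/((Posz (x \in S))%:~R)%R Sx // rmorph_sum /=.
  by apply: eq_bigr => p _; rewrite !mxE rmorphM.
pose Bs := [seq mxC p.2 | p : int * {group gT} <- r].
have cBs : {in Bs &, forall B C, B *m C = C *m B}.
  move=> _ _ /mapP[p rp ->] /mapP[q rq ->].
  by case/orP: (nr p q rp rq) => ?; [symmetry|]; apply: adjacency_Cay_comm;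
    rewrite ?sG.
have [|||v [nzv vA vBs]] := @common_eigenvector _ Bs _ _ Aa.
- move=> _ /mapP[p rp ->]; exists (#|p.2|%:R)%R; first exact: rpred_nat.
  by rewrite adjacency_Cay_sqr ?sG.
- move=> _ /mapP[p rp ->]; rewrite defA mulmx_sumr mulmx_suml.
  rewrite big_seq [RHS]big_seq; apply: eq_bigr => q rq.
  by rewrite -scalemxAr -scalemxAl (cBs (mxC p.2)) ?map_f //; apply: map_f.
- by [].
have [b Zb vAb] : exists2 b, b \in Num.int & v *m mxC S = (b *: v)%R.
  rewrite defA mulmx_sumr big_seq.
  apply: (big_ind (fun w => exists2 b, b \in Num.int & w = (b *: v)%R)).
  - by exists 0%R; rewrite ?rpred0 ?scale0r.
  - move=> _ _ [b Zb ->] [c Zc ->].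
    by exists (b + c)%R; rewrite ?rpredD ?scalerDl.
  move=> p rp; have [|b Zb vB] := vBs (mxC p.2); first by apply: map_f.
  exists (p.1%:~R * b)%R; first by rewrite rpredM ?rpred_int.
  by rewrite -scalemxAr vB scalerA.
suff -> : a = b by [].
apply/eqP; rewrite -subr_eq0; apply: contraNT nzv => ab.
by rewrite -(inj_eq (scalerI ab)) scaler0 scalerBl -vA vAb subrr.
Qed.

End CayleyMatrix.

(** * Constraints on the subgroups of a CIS group *)

Section CISGroup.

Variables (gT : finGroupType) (G : {group gT}).
Hypothesis cisG : CIS G.
Implicit Types (S : {set gT}) (H K N Q : {group gT}).

(* Non-adjacency in a complete multipartite graph is an equivalence relation,
   and [G :\: S] is the class of [1] for it. *)
Lemma CIS_group_set S : S \subset G -> S^-1 = S -> 1 \notin S ->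
    connected_graph (Cay G S) -> integral_graph (Cay G S) ->
  group_set (G :\: S).
Proof.
move=> sSG SV S1 connS intS.
have [P _ eP] := cisG sSG SV S1 connS intS.
have nadj x y : x \in G -> y \in G ->
  (x * y^-1 \in S) = (pblock P (subg G x) != pblock P (subg G y)).
  by move=> xG yG; rewrite -eP /Cay !subgK.
have nS x : x \in G :\: S ->
    x \in G /\ pblock P (subg G x) = pblock P (subg G 1).
  by case/setDP=> xG; rewrite -{1}[x]mulg1 -{1}invg1 nadj // negbK => /eqP.
apply/group_setP; split=> [|x y xS yS]; first by rewrite inE S1 group1.
have [[xG xP] [yG yP]] := (nS x xS, nS y yS).
have yVP : y^-1 \in G :\: S.
  by case/setDP: yS => _; rewrite -[in X in X -> _]SV inE => yS;
    rewrite inE yS groupV.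
have [yVG yVP'] := nS _ yVP.
by rewrite inE groupM // andbT -{1}[y]invgK nadj // negbK xP yVP'.
Qed.

(* The complement of the graph with connection set [(G :\: H) :|: K^#] is a
   disjoint union of copies of a complete multipartite graph on [H]. *)
Lemma CIS_proper_subgroup H K : H \proper G -> K \subset H ->
  K :=: 1 \/ K :=: H.
Proof.
move=> /andP[sHG nsGH] sKH; have sKG := subset_trans sKH sHG.
pose S := (G :\: H) :|: K^#.
have SV : S^-1 = S by apply/setP=> x; rewrite !inE !groupV eq_invg1.
have gS : group_set (G :\: S).
  apply: CIS_group_set => //.
  - by rewrite subUset subsetDl subDset subsetU ?sKG ?orbT.
  - by rewrite !inE eqxx group1.
  - have adj x y : sgval x * (sgval y)^-1 \notin H -> connect (Cay G S) x y.
      move=> nH; apply: connect1; rewrite /Cay !inE nH /=.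
      by rewrite groupM ?groupV ?subgP.
    (* Two vertices in one coset of [H] are joined through [g * x], which lies outside that
       coset. *)
    move=> x y; have [xyH | /adj//] := boolP (sgval x * (sgval y)^-1 \in H).
    have [g gG gH] := subsetPn nsGH.
    have gxE : sgval (subg G (g * sgval x)) = g * sgval x.
      by rewrite subgK // groupM ?subgP.
    apply: (@connect_trans _ _ (subg G (g * sgval x))); apply: adj.
      by rewrite gxE invMg mulVKg groupV.
    by rewrite gxE -mulgA groupMr.
  (* The indicator of [S] is that of [G], minus [H], plus [K], minus the identity. *)
  - pose r := [:: (1%R, G); ((-1)%R, H); (1%R, K); ((-1)%R : int, 1%G)].
    apply: (@integral_Cay_span _ _ r).
    + by move=> p; rewrite !inE => /or4P[]/eqP-> /=; rewrite ?sub1G.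
    + have nK : K \subset 'N(H) := subset_trans sKH (normG H).
      have nHG : H \subset 'N(G) := subset_trans sHG (normG G).
      have nKG : K \subset 'N(G) := subset_trans sKG (normG G).
      move=> p q; rewrite !inE.
      by case/or4P=> /eqP-> /or4P[]/eqP-> /=;
        rewrite ?normG ?sub1G ?norms1 ?nK ?nHG ?nKG ?orbT ?norm1 ?subsetT ?orbT.
    + move=> x xG; rewrite !big_cons big_nil !inE xG /=.
      have [->|_] := eqVneq x 1; first by rewrite !group1.
      have [xK | _] := boolP (x \in K); first by rewrite (subsetP sKH).
      by case: (x \in H).
have [L defL] : exists L : {group gT}, L :=: G :\: S by exists (Group gS).
have memL x : x \in H -> (x \in L) = (x == 1) || (x \notin K).
  by move=> xH; rewrite defL !inE xH (subsetP sHG) // andbT; case: eqP.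
have [K0 | [k /setD1P[k1 kK]]] := set_0Vmem K^#.
  by left; apply/trivgP; rewrite -setD_eq0 K0.
(* For [h] in [H] outside [K], both [h] and [h * k] lie in [L], hence so does [k]; but [L] meets [K]
   trivially. *)
right; apply/eqP; rewrite eqEsubset sKH; apply/subsetP=> h hH.
apply: contraR k1 => hK; have kH := subsetP sKH k kK.
have hL : h \in L by rewrite memL ?hK ?orbT.
have : h * k \in L by rewrite memL ?(groupM hH kH) // groupMr // hK orbT.
by rewrite groupMl // memL // kK orbF.
Qed.

(* Adjacency matrices of the subgroups [N] and [Q] commute, so connection set
   [(N :|: Q)^#] gives an integral graph; the complement [L] is then a subgroup
   of order [(#|N| - 1) * (#|Q| - 1) + 1] meeting both [N] and [Q] trivially,
   and [#|L| * #|N|, #|L| * #|Q| <= #|G|] forces both orders to be [2]. *)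
Lemma CIS_normal_complement N Q : N <| G -> N :&: Q = 1 -> N * Q = G ->
  N :!=: 1 -> Q :!=: 1 -> #|N| = 2 /\ #|Q| = 2.
Proof.
move=> nsNG tiNQ defG ntN ntQ.
have [sNG nNG] := andP nsNG.
have sQG : Q \subset G by rewrite -defG mulG_subr.
pose S := (N :|: Q)^#.
have SV : S^-1 = S by apply/setP=> x; rewrite !inE !groupV eq_invg1.
have NQ1 x : x \in N -> x \in Q -> x = 1.
  by move=> xN xQ; apply/set1P; rewrite -set1gE -tiNQ inE xN.
have gS : group_set (G :\: S).
  apply: CIS_group_set => //.
  - by rewrite subDset subUset !subsetU ?sNG ?sQG ?orbT.
  - by rewrite !inE eqxx.
  - move=> x y; have adj u v : sgval u * (sgval v)^-1 \in N :|: Q ->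
        connect (Cay G S) u v.
      move=> uvNQ; have [uv1 | uv1] := eqVneq (sgval u * (sgval v)^-1) 1.
        suff -> : u = v by exact: connect0.
        by apply: val_inj; apply/eqP; rewrite eq_mulgV1; apply/eqP.
      by apply: connect1; rewrite /Cay in_setD1 uv1.
    (* Writing [x * y^-1 = n * q] gives a path from [x] to [y] through [n^-1 * x]. *)
    have : sgval x * (sgval y)^-1 \in N * Q.
      by rewrite defG groupM ?groupV ?subgP.
    case/mulsgP=> n q nN qQ xy.
    have zE : sgval (subg G (n^-1 * sgval x)) = n^-1 * sgval x.
      by rewrite subgK // groupM ?groupV ?subgP // (subsetP sNG).
    apply: (@connect_trans _ _ (subg G (n^-1 * sgval x))); apply: adj.
      by rewrite zE invMg invgK mulVKg inE nN.
    by rewrite zE -mulgA xy mulKg inE qQ orbT.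
  (* The coefficient -2 removes the identity, counted once in [N] and once in [Q]. *)
  - pose r := [:: (1%R : int, N); (1%R, Q); ((- 2%:Z)%R, 1%G)].
    apply: (@integral_Cay_span _ _ r).
    + by move=> p; rewrite !inE => /or3P[]/eqP-> /=; rewrite ?sub1G.
    + have nQ : Q \subset 'N(N) := subset_trans sQG nNG.
      move=> p q; rewrite !inE.
      by case/or3P=> /eqP-> /or3P[]/eqP-> /=;
        rewrite ?normG ?sub1G ?nQ ?norm1 ?subsetT ?orbT.
    + move=> x xG; rewrite !big_cons big_nil !inE /=.
      have [->|x1] := eqVneq x 1; first by rewrite !group1.
      have [xN | _] := boolP (x \in N); have [xQ | _] //= := boolP (x \in Q).
      by rewrite (NQ1 x xN xQ) eqxx in x1.
pose L := Group gS.
have oNQ : #|N :|: Q| = (#|N| + #|Q| - 1)%N by rewrite cardsU tiNQ cards1.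
have oG : #|G| = (#|N| * #|Q|)%N by rewrite -defG TI_cardMg.
have oL : (#|L| + (#|N| + #|Q|) = #|N| * #|Q| + 2)%N.
  have sSG : S \subset G by rewrite subDset subUset !subsetU ?sNG ?sQG ?orbT.
  have := cardsD1 1 (N :|: Q); rewrite inE group1 oNQ -/S orTb => oS.
  have oGS : #|L| = (#|G| - #|S|)%N by rewrite /= cardsD (setIidPr sSG).
  have := subset_leq_card sSG; have := cardG_gt0 N; have := cardG_gt0 Q.
  rewrite -oG oGS; move: oS; move: #|N| #|Q| #|G| #|S| => n q g s; lia.
have leL (H : {group gT}) : H \subset G -> H \subset N :|: Q ->
    (#|L| * #|H| <= #|N| * #|Q|)%N.
  move=> sHG sHNQ; rewrite -TI_cardMg.
    by rewrite -oG subset_leq_card // mul_subG // subsetDl.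
  apply/trivgP/subsetP=> x /setIP[/setDP[_ xS] xH]; rewrite inE.
  by apply: contraNT xS => x1; rewrite !inE x1 -in_setU (subsetP sHNQ).
have leN := leL N sNG (subsetUl N Q); have leQ := leL Q sQG (subsetUr N Q).
have gtN : (1 < #|N|)%N by rewrite cardG_gt1.
have gtQ : (1 < #|Q|)%N by rewrite cardG_gt1.
have leLQ : (#|L| <= #|Q|)%N 
  by rewrite -(@leq_pmul2r #|N|) ?(ltnW gtN) // (mulnC #|Q|).
have leLN : (#|L| <= #|N|)%N.
  by rewrite -(@leq_pmul2r #|Q|) ?(ltnW gtQ).
(* Cancelling [#|N| - 1] in [leLN] leaves [#|Q| <= 2]; symmetrically [leLQ] bounds [#|N|]. *)
by split; nia.
Qed.

End CISGroup.

(* A subgroup of prime order that is not normal is its own normalizer, hence a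
   Frobenius complement; the Frobenius kernel is then the normal subgroup. *)
Lemma prime_proper_subgroups_normal (gT : finGroupType) (G : {group gT}) :
    G :!=: 1 ->
    (forall H : {group gT}, H \proper G -> H :!=: 1 -> prime #|H|) ->
  exists2 N : {group gT}, N <| G & prime #|N|.
Proof.
move=> ntG prG.
have p_pr : prime (pdiv #|G|) by rewrite pdiv_prime ?cardG_gt1.
have [x xG ox] := Cauchy p_pr (pdiv_dvd _).
pose M := <[x]>%G; have prM : prime #|M| by rewrite -/(#[x]) ox.
have sMG : M \subset G by rewrite cycle_subG.
have ntM : M :!=: 1 by rewrite -cardG_gt1 prime_gt1.
have [nMG | nMG] := boolP (G \subset 'N(M)).
  by exists M; rewrite /normal ?sMG.
have neMG : M :!=: G by apply: contraNneq nMG => ->; exact: normG.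
have defN : 'N_G(M) = M.
  have prN : prime #|'N_G(M)|.
    apply: prG; first by rewrite properE subsetIl subsetI subxx.
    rewrite -!cardG_gt1 in ntM *; apply: leq_trans ntM (subset_leq_card _).
    by rewrite subsetI sMG normG.
  apply/eqP; rewrite eq_sym eqEcard subsetI sMG normG /=.
  have := cardSg (_ : M \subset 'N_G(M)); rewrite subsetI sMG normG.
  by move=> /(_ isT); rewrite dvdn_prime2 // => /eqP->.
have frobM : [Frobenius G with complement M].
  rewrite /Frobenius_group_with_complement neMG; apply/normedTI_P; split.
  - by rewrite setD_eq0 subG1.
  - by rewrite -{1}defN normD1.
  (* Since [M] has prime order, meeting its conjugate by [g] nontrivially forces equality, so [g]
     normalizes [M]. *)
  move=> g gG; case/pred0Pn=> z /andP[/setD1P[z1 zM] zMg].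
  rewrite -defN inE gG; apply/normP; apply/eqP.
  rewrite eq_sym eqEcard cardJg leqnn andbT; apply: contraR z1 => nsM.
  rewrite -in_set1 -set1gE -(prime_TIg prM nsM) inE zM.
  by move: zMg; rewrite conjD1g => /setD1P[].
have [K /andP[/eqP defG _]] := Frobenius_kernel_exists frobM.
have [nsKG _ defKM _ tiKM] := sdprod_context defG.
exists K => //; apply: prG.
  rewrite properEneq normal_sub // andbT.
  apply: contraNneq ntM => defK; rewrite -subG1 -tiKM subsetI subxx andbT /=.
  by rewrite defK.
by apply: contraNneq neMG => K1; rewrite -defKM K1 mul1g.
Qed.

(** * Classification of CIS groups *)

Theorem theorem3p3 (gT : finGroupType) (G : {group gT})
    (ntG : G :!=: 1) (cisG : CIS G) :
  abelian G /\
  ((exists2 p : nat, prime p &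
      G \isog [set: 'Z_p] \/ G \isog [set: 'Z_(p ^ 2)%N]) \/
   G \isog [set: 'Z_2 * 'Z_2]).
Proof.
have prG (H : {group gT}) : H \proper G -> H :!=: 1 -> prime #|H|.
  move=> pHG ntH.
  have q_pr : prime (pdiv #|H|) by rewrite pdiv_prime ?cardG_gt1.
  have [x xH ox] := Cauchy q_pr (pdiv_dvd _).
  have sxH : <[x]>%G \subset H by rewrite cycle_subG.
  case: (CIS_proper_subgroup cisG pHG sxH) => /= [x1 | <-].
    by rewrite -ox /order x1 cards1 in q_pr.
  by rewrite -/(#[x]) ox.
have isoZ n : (1 < n)%N -> cyclic G -> #|G| = n -> G \isog [set: 'Z_n].
  move=> n1 cycG oG; rewrite isog_cyclic_card //.
  rewrite cardsT card_ord Zp_cast // oG eqxx andbT.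
  by apply/cyclicP; exists Zp1; exact: Zp_cycle.
have split_case (N Q : {group gT}) : N <| G -> prime #|N| -> prime #|Q| ->
    Q \subset G -> N :&: Q = 1 ->
  [/\ #|N| = 2, #|Q| = 2, abelian G & G \isog [set: 'Z_2 * 'Z_2]].
  move=> nsNG prN prQ sQG tiNQ; have [sNG nNG] := andP nsNG.
  have ntN : N :!=: 1 by rewrite -cardG_gt1 prime_gt1.
  have ntQ : Q :!=: 1 by rewrite -cardG_gt1 prime_gt1.
  have nNQ := subset_trans sQG nNG.
  have oNQ : #|N <*> Q| = (#|N| * #|Q|)%N by rewrite norm_joinEr // TI_cardMg.
  have defG : N * Q = G.
    rewrite -norm_joinEr //; apply/eqP; apply: contraT => neG.
    (* A proper join would have prime order, yet its order is the composite [#|N| * #|Q|]. *)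
    have : prime #|N <*> Q|.
      apply: prG; first by rewrite properEneq neG join_subG sNG.
      rewrite -cardG_gt1 oNQ.
      exact: leq_trans (prime_gt1 prN) (leq_pmulr _ (prime_gt0 prQ)).
    case/primeP=> _ /(_ #|N|); rewrite oNQ dvdn_mulr // => /(_ isT).
    case/pred2P=> oN; first by rewrite oN in prN.
    move/eqP: oN; rewrite -[X in X == _]muln1 eqn_pmul2l ?prime_gt0 //.
    by rewrite ltn_eqF ?prime_gt1.
  have [oN oQ] := CIS_normal_complement cisG nsNG tiNQ defG ntN ntQ.
  have oG : #|G| = 4 by rewrite -defG TI_cardMg // oN oQ.
  have abG : abelian G by apply: (@card_p2group_abelian _ 2).
  have dprodG : N \x Q = G by rewrite dprodE // (sub_abelian_cent2 abG).
  have abelG : 2.-abelem G by rewrite (dprod_abelem 2 dprodG) !prime_abelem.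
  split=> //; rewrite (isog_abelem_card _ abelG) cardsT card_prod !card_ord oG.
  rewrite andbT.
  rewrite abelemE //; apply/andP; split.
    by apply/centsP=> [[a b] _ [c d] _]; congr (_, _); apply: addrC.
  apply/exponentP=> [[a b] _]; apply/eqP.
  by case: a b => [[|[|]]] // ? [[|[|]]].
have [N nsNG prN] := prime_proper_subgroups_normal ntG prG.
have [sNG nNG] := andP nsNG.
set p := #|N| in prN.
(* An element of prime order [q] other than [p] would generate a complement to [N], forcing
   [p = q = 2]. *)
have [pG | ] := boolP (p.-group G); last first.
  rewrite /pgroup /pnat cardG_gt0 => /allPn[q].
  rewrite mem_primes => /and3P[q_pr _ qG] neqp.
  have [x xG ox] := Cauchy q_pr qG.
  have [|||oN oQ _ _] := split_case N <[x]>%G nsNG prN.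
  - by rewrite -/(#[x]) ox.
  - by rewrite cycle_subG.
  - apply: prime_TIg => //; apply: contra neqp => sNx.
    by have := cardSg sNx; rewrite -/(#[x]) ox dvdn_prime2 // inE eq_sym.
  by case/negP: neqp; rewrite inE -ox /order oQ /p oN.
have [cycG | ncycG] := boolP (cyclic G).
  split; first exact: cyclic_abelian.
  left; exists p => //.
  (* Either [N] is [G], or a maximal [M] containing [N] has prime order, so order [p], and has index
     [p]. *)
  have [defN | [M maxM sNM]] := maximal_exists sNG.
    by left; apply: isoZ; rewrite ?prime_gt1 // -defN.
  right; apply: isoZ => //; first by rewrite (ltn_exp2l 0) ?prime_gt1.
  have prM : prime #|M|.
    apply: prG (maxgroupp maxM) _; rewrite -cardG_gt1.
    exact: leq_trans (prime_gt1 prN) (subset_leq_card sNM).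
  have := cardSg sNM; rewrite dvdn_prime2 // => /eqP oM.
  rewrite -(Lagrange (proper_sub (maxgroupp maxM))) (p_maximal_index pG maxM).
  by rewrite -oM -/p -mulnn.
have neNG : ~~ (G \subset N).
  apply: contra ncycG => sGN.
  have <- : N :=: G by apply/eqP; rewrite eqEsubset sNG.
  exact: prime_cyclic.
(* As [G] is not cyclic, [x] generates a proper subgroup, of prime order and not inside [N]: a
   complement to [N]. *)
have [x xG xN] := subsetPn neNG.
have pxG : <[x]>%G \proper G.
  rewrite properEneq cycle_subG xG andbT.
  by apply: contraNneq ncycG => <-; exact: cycle_cyclic.
have prx : prime #|<[x]>|.
  apply: prG pxG _; rewrite cycle_eq1.
  by apply: contraNneq xN => ->; exact: group1.
have [||_ _ abG isoG] := split_case N <[x]>%G nsNG prN prx.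
- exact: proper_sub pxG.
- by rewrite setIC; apply: prime_TIg prx _; rewrite cycle_subG.
by split; last right.
Qed.
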